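(* Let $\mathfrak g,\mathfrak h$ be finite-dimensional Lie algebras over a field $K$ with finite-dimensional representations $(V_{\mathfrak g},\rho_{\mathfrak g})$, $(V_{\mathfrak h},\rho_{\mathfrak h})$ respectively. Let $T_{\mathfrak g}:V_{\mathfrak g}\to\mathfrak g$ be an $\mathcal O$-operator associated to $(V_{\mathfrak g},\rho_{\mathfrak g})$ and $T_{\mathfrak h}:V_{\mathfrak h}\to\mathfrak h$ an $\mathcal O$-operator associated to $(V_{\mathfrak h},\rho_{\mathfrak h})$. If $(\phi,\alpha)$ is a homomorphism of $\mathcal O$-operators from $T_{\mathfrak g}$ to $T_{\mathfrak h}$, then $\alpha$ is a homomorphism of pre-Lie algebras from $(V_{\mathfrak g},\cdot_{T_{\mathfrak g}})$ to $(V_{\mathfrak h},\cdot_{T_{\mathfrak h}})$. The assignments $T_{\mathfrak g}\mapsto(V_{\mathfrak g},\cdot_{T_{\mathfrak g}})$ and $(\phi,\alpha)\mapsto\alpha$ define a functor $G$ from the category $\mathbf{OP}$ of $\mathcal O$-operators to the category $\mathbf{PL}$ of pre-Lie algebras. Furthermore, $G$ is right adjoint to the functor $F:\mathbf{PL}\to\mathbf{OP}$ given by $(A,\cdot)\mapsto(\mathrm{id}_A:A\to\mathfrak g(A))$ and $\phi\mapsto(\phi,\phi)$.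
   Context: All spaces are finite dimensional over a field $K$. A pre-Lie algebra is a vector space $A$ with a bilinear product $\cdot$ such that $x\cdot(y\cdot z)-(x\cdot y)\cdot z=y\cdot(x\cdot z)-(y\cdot x)\cdot z$ for all $x,y,z\in A$. A homomorphism of pre-Lie algebras is a linear map preserving the products; $\mathbf{PL}$ is the resulting category. The sub-adjacent Lie algebra $\mathfrak g(A)$ is $A$ with bracket $[a,b]=a\cdot b-b\cdot a$; $L(a)b=a\cdot b$ defines a representation of $\mathfrak g(A)$ on $A$, and $\mathrm{id}_A:A\to\mathfrak g(A)$ is an $\mathcal O$-operator associated to $(A,L)$. An $\mathcal O$-operator on a Lie algebra $\mathfrak g$ associated to a representation $(V,\rho)$ is a linear map $T:V\to\mathfrak g$ with $[T(u),T(v)]=T(\rho(T(u))v-\rho(T(v))u)$ for all $u,v\in V$. For such $T$, the product $u\cdot_T v:=\rho(T(u))v$ is known to make $V$ a pre-Lie algebra $(V,\cdot_T)$. A (coherent) homomorphism of $\mathcal O$-operators from $T_{\mathfrak g}$ to $T_{\mathfrak h}$ is a pair $(\phi,\alpha)$ with $\phi:\mathfrak g\to\mathfrak h$ a Lie algebra homomorphism and $\alpha:V_{\mathfrak g}\to V_{\mathfrak h}$ linear such that $\alpha(\rho_{\mathfrak g}(x)v)=\rho_{\mathfrak h}(\phi(x))(\alpha(v))$ for all $x\in\mathfrak g,v\in V_{\mathfrak g}$, and $T_{\mathfrak h}\alpha=\phi T_{\mathfrak g}$. $\mathbf{OP}$ is the category of $\mathcal O$-operators with these morphisms (composed componentwise).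 *)

(* Defs.v *)
From HB Require Import structures.
From mathcomp Require Import all_boot all_algebra.
From mathcomp Require Import boolp.
Set Implicit Arguments.
Unset Strict Implicit.
Unset Printing Implicit Defensive.
Import GRing.Theory.
Local Open Scope ring_scope.

Record category := Category {
  obj :> Type;
  mor : obj -> obj -> Type;
  idm : forall a, mor a a;
  cmp : forall a b c, mor b c -> mor a b -> mor a c;
  cmp1m : forall a b (f : mor a b), cmp (idm b) f = f;
  cmpm1 : forall a b (f : mor a b), cmp f (idm a) = f;
  cmpA : forall a b c d (h : mor c d) (g : mor b c) (f : mor a b),
    cmp h (cmp g f) = cmp (cmp h g) f
}.
Arguments mor : clear implicits.
Arguments idm : clear implicits.

Definition is_functor (C D : category) (F0 : C -> D)
    (F1 : forall a b : C, mor C a b -> mor D (F0 a) (F0 b)) : Prop :=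
  (forall a, F1 a a (idm C a) = idm D (F0 a)) /\
  (forall a b c (g : mor C b c) (f : mor C a b),
     F1 a c (cmp g f) = cmp (F1 b c g) (F1 a b f)).

Record functor (C D : category) := Functor {
  fobj :> C -> D;
  fmor : forall a b : C, mor C a b -> mor D (fobj a) (fobj b);
  fmorP : is_functor fmor
}.
Arguments fmor {C D} f {a b}.

(* [right_adjoint G F]: G is right adjoint to F, via a family of bijections   *)
(* D(F a, b) -> C(a, G b) natural in a and b.                                 *)
Definition right_adjoint (C D : category) (G : functor D C) (F : functor C D) :
    Prop :=
  exists Phi : forall (a : C) (b : D), mor D (F a) b -> mor C a (G b),
    [/\ forall a b, bijective (Phi a b),
        forall (a a' : C) (b : D) (u : mor C a' a) (f : mor D (F a) b),
          Phi a' b (cmp f (fmor F u)) = cmp (Phi a b f) u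
      & forall (a : C) (b b' : D) (v : mor D b b') (f : mor D (F a) b),
          Phi a b' (cmp v f) = cmp (fmor G v) (Phi a b f)].

Record pre_lie (K : fieldType) := PreLie {
  pl_space :> vectType K;
  pl_mul : {bilinear pl_space -> pl_space -> pl_space};
  pl_mulP : forall x y z : pl_space,
    pl_mul x (pl_mul y z) - pl_mul (pl_mul x y) z
    = pl_mul y (pl_mul x z) - pl_mul (pl_mul y x) z
}.
Arguments pl_mul {K p}.

Record lie_algebra (K : fieldType) := LieAlgebra {
  lie_space :> vectType K;
  lie_br : {bilinear lie_space -> lie_space -> lie_space};
  lie_brxx : forall x : lie_space, lie_br x x = 0;
  lie_jacobi : forall x y z : lie_space,
    lie_br x (lie_br y z) + lie_br y (lie_br z x) + lie_br z (lie_br x y) = 0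
}.
Arguments lie_br {K l}.

Record representation (K : fieldType) (g : lie_algebra K) := Representation {
  rep_space :> vectType K;
  rep_act : 'Hom(g, 'End(rep_space));
  rep_actP : forall (x y : g) (v : rep_space),
    rep_act (lie_br x y) v = rep_act x (rep_act y v) - rep_act y (rep_act x v)
}.

Record o_operator (K : fieldType) := OOperator {
  op_lie : lie_algebra K;
  op_rep : representation op_lie;
  op_map :> 'Hom(op_rep, op_lie);
  op_mapP : forall u v : op_rep,
    lie_br (op_map u) (op_map v)
    = op_map (rep_act op_rep (op_map u) v - rep_act op_rep (op_map v) u)
}.
Arguments op_lie {K} o.
Arguments op_rep {K} o.

Definition is_pl_hom (K : fieldType) (A B : pre_lie K) (f : 'Hom(A, B)) : Prop :=
  forall x y : A, f (pl_mul x y) = pl_mul (f x) (f y).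

Definition is_lie_hom (K : fieldType) (g h : lie_algebra K) (f : 'Hom(g, h)) :
    Prop :=
  forall x y : g, f (lie_br x y) = lie_br (f x) (f y).

Definition is_op_hom (K : fieldType) (S T : o_operator K)
    (phi : 'Hom(op_lie S, op_lie T)) (alpha : 'Hom(op_rep S, op_rep T)) : Prop :=
  [/\ is_lie_hom phi,
      forall (x : op_lie S) (v : op_rep S),
        alpha (rep_act (op_rep S) x v) = rep_act (op_rep T) (phi x) (alpha v)
    & (T \o alpha)%VF = (phi \o S)%VF].

Record pl_hom (K : fieldType) (A B : pre_lie K) := PLHom {
  plh_map :> 'Hom(A, B);
  plh_mapP : is_pl_hom plh_map
}.

Record op_hom (K : fieldType) (S T : o_operator K) := OPHom {
  oph_lie : 'Hom(op_lie S, op_lie T);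
  oph_rep : 'Hom(op_rep S, op_rep T);
  oph_P : is_op_hom oph_lie oph_rep
}.

Section PL.
Variable K : fieldType.
Implicit Types A B C D : pre_lie K.

Lemma pl_hom_eq A B (f g : pl_hom A B) : plh_map f = plh_map g -> f = g.
Proof.
case: f g => [f fP] [g gP] /= efg; case: g / efg in gP *.
by rewrite (Prop_irrelevance fP gP).
Qed.

Fact pl_idP A : is_pl_hom (\1%VF : 'Hom(A, A)).
Proof. by move=> x y; rewrite !lfunE. Qed.
Definition pl_id A : pl_hom A A := PLHom (@pl_idP A).

Fact pl_compP A B C (g : pl_hom B C) (f : pl_hom A B) :
  is_pl_hom (plh_map g \o plh_map f)%VF.
Proof. by move=> x y; rewrite !lfunE /= !plh_mapP. Qed.
Definition pl_comp A B C (g : pl_hom B C) (f : pl_hom A B) : pl_hom A C :=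
  PLHom (pl_compP g f).

Fact pl_comp1m A B (f : pl_hom A B) : pl_comp (pl_id B) f = f.
Proof. by apply: pl_hom_eq; rewrite /= comp_lfun1l. Qed.

Fact pl_compm1 A B (f : pl_hom A B) : pl_comp f (pl_id A) = f.
Proof. by apply: pl_hom_eq; rewrite /= comp_lfun1r. Qed.

Fact pl_compA A B C D (h : pl_hom C D) (g : pl_hom B C) (f : pl_hom A B) :
  pl_comp h (pl_comp g f) = pl_comp (pl_comp h g) f.
Proof. by apply: pl_hom_eq; rewrite /= comp_lfunA. Qed.

Definition PL : category := Category pl_comp1m pl_compm1 pl_compA.

End PL.

Section OP.
Variable K : fieldType.
Implicit Types R S T U : o_operator K.

Lemma op_hom_eq S T (f g : op_hom S T) :
  oph_lie f = oph_lie g -> oph_rep f = oph_rep g -> f = g.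
Proof.
case: f g => [f1 f2 fP] [g1 g2 gP] /= e1 e2.
case: g1 / e1 in gP *; case: g2 / e2 in gP *.
by rewrite (Prop_irrelevance fP gP).
Qed.

Fact op_idP T : is_op_hom (\1%VF : 'End(op_lie T)) (\1%VF : 'End(op_rep T)).
Proof.
split; first by move=> x y; rewrite !lfunE.
  by move=> x v; rewrite !lfunE.
by rewrite comp_lfun1l comp_lfun1r.
Qed.
Definition op_id T : op_hom T T := OPHom (op_idP T).

Fact op_compP R S T (g : op_hom S T) (f : op_hom R S) :
  is_op_hom (oph_lie g \o oph_lie f)%VF (oph_rep g \o oph_rep f)%VF.
Proof.
case: g f => [g1 g2 [g1M g2M gT]] [f1 f2 [f1M f2M fS]] /=; split.
- by move=> x y; rewrite !lfunE /= f1M g1M.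
- by move=> x v; rewrite !lfunE /= f2M g2M.
- by rewrite comp_lfunA gT -comp_lfunA fS comp_lfunA.
Qed.
Definition op_comp R S T (g : op_hom S T) (f : op_hom R S) : op_hom R T :=
  OPHom (op_compP g f).

Fact op_comp1m S T (f : op_hom S T) : op_comp (op_id T) f = f.
Proof. by apply: op_hom_eq; rewrite /= comp_lfun1l. Qed.

Fact op_compm1 S T (f : op_hom S T) : op_comp f (op_id S) = f.
Proof. by apply: op_hom_eq; rewrite /= comp_lfun1r. Qed.

Fact op_compA R S T U (h : op_hom T U) (g : op_hom S T) (f : op_hom R S) :
  op_comp h (op_comp g f) = op_comp (op_comp h g) f.
Proof. by apply: op_hom_eq; rewrite /= comp_lfunA. Qed.

Definition OP : category := Category op_comp1m op_compm1 op_compA.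

End OP.

Fact sub_swap (V : zmodType) (a b x y : V) : x - a = y - b -> a - b = x - y.
Proof.
by move/eqP; rewrite subr_eq => /eqP->; rewrite -addrA addrC subrKA.
Qed.

Section InducedPreLie.
Variables (K : fieldType) (T : o_operator K).

Definition op_mul (u v : op_rep T) : op_rep T := rep_act (op_rep T) (T u) v.

Fact op_mul_bilinear : bilinear_for *:%R *:%R op_mul.
Proof.
split=> [v|u] a x y; rewrite /op_mul; last by rewrite linearP.
by rewrite !linearP /= !lfunE /= !lfunE.
Qed.
HB.instance Definition _ :=
  bilinear_isBilinear.Build K (op_rep T) (op_rep T) (op_rep T)
    *:%R *:%R op_mul op_mul_bilinear.

Fact op_mulP (x y z : op_rep T) :
  op_mul x (op_mul y z) - op_mul (op_mul x y) z
  = op_mul y (op_mul x z) - op_mul (op_mul y x) z.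
Proof.
have := rep_actP (T x) (T y) z.
rewrite op_mapP linearB linearB /= add_lfunE opp_lfunE -!/(op_mul _ _) => e.
by apply: sub_swap; rewrite -opprB -e opprB.
Qed.

Definition induced_pre_lie : pre_lie K := @PreLie K (op_rep T) op_mul op_mulP.

End InducedPreLie.

Section Subadjacent.
Variables (K : fieldType) (A : pre_lie K).

Definition pl_br (a b : A) : A := pl_mul a b - pl_mul b a.

Fact pl_br_bilinear : bilinear_for *:%R *:%R pl_br.
Proof.
by split=> [b|a] k x y;
  rewrite /pl_br /= linearPl linearPr scalerBr opprD addrACA.
Qed.
HB.instance Definition _ :=
  bilinear_isBilinear.Build K A A A *:%R *:%R pl_br pl_br_bilinear.

Fact pl_brxx (x : A) : pl_br x x = 0.
Proof. exact: subrr. Qed.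

Fact pl_br_act (x y z : A) :
  pl_mul (pl_br x y) z = pl_mul x (pl_mul y z) - pl_mul y (pl_mul x z).
Proof.
by rewrite linearBl; apply: sub_swap; apply: pl_mulP.
Qed.

Fact pl_br_jacobi (x y z : A) :
  pl_br x (pl_br y z) + pl_br y (pl_br z x) + pl_br z (pl_br x y) = 0.
Proof.
have E u v w : pl_br u (pl_br v w)
    = (pl_mul u (pl_mul v w) - pl_mul v (pl_mul w u))
      - (pl_mul u (pl_mul w v) - pl_mul w (pl_mul v u)).
  by rewrite {1}/pl_br pl_br_act linearBr [in LHS]opprD addrACA -opprD.
rewrite !E.
move: (pl_mul x (pl_mul y z)) (pl_mul y (pl_mul z x)) (pl_mul z (pl_mul x y)).
move: (pl_mul x (pl_mul z y)) (pl_mul y (pl_mul x z)) (pl_mul z (pl_mul y x)).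
move=> b e d a c f.
rewrite [X in X + _]addrACA -opprD addrACA -opprD.
by rewrite [X in _ - (X + _)]addrC !subrKA !subrr.
Qed.

Definition subadjacent : lie_algebra K :=
  @LieAlgebra K A pl_br pl_brxx pl_br_jacobi.

Definition lmul (a : A) : 'End(A) := linfun (pl_mul a).

Fact lmul_linear : linear lmul.
Proof.
move=> k a b; apply/lfunP=> c.
by rewrite add_lfunE scale_lfunE !lfunE /= linearPl.
Qed.
HB.instance Definition _ :=
  GRing.isLinear.Build K A 'End(A) *:%R lmul lmul_linear.

Fact lmulE (a b : A) : linfun lmul a b = pl_mul a b.
Proof. by rewrite (lfunE lmul) /= /lmul lfunE. Qed.

Fact lmul_actP (x y : subadjacent) (v : A) :
  linfun lmul (lie_br x y) v
  = linfun lmul x (linfun lmul y v) - linfun lmul y (linfun lmul x v).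
Proof. by rewrite !lmulE; apply: pl_br_act. Qed.

Definition left_mul_rep : representation subadjacent :=
  @Representation K subadjacent A (linfun lmul) lmul_actP.

Fact id_opP (u v : left_mul_rep) (i := \1%VF : 'Hom(left_mul_rep, subadjacent)) :
  lie_br (i u) (i v)
  = i (rep_act left_mul_rep (i u) v - rep_act left_mul_rep (i v) u).
Proof. by rewrite /i /= !id_lfunE !lmulE. Qed.

Definition id_op : o_operator K :=
  @OOperator K subadjacent left_mul_rep \1%VF id_opP.

End Subadjacent.

Section FunctorF.
Variable K : fieldType.

Fact id_op_homP (A B : pre_lie K) (f : pl_hom A B) :
  @is_op_hom K (id_op A) (id_op B) f f.
Proof.
split; last by rewrite comp_lfun1l comp_lfun1r.
  by move=> x y; rewrite /= /pl_br linearB /= !plh_mapP.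
by move=> x v; rewrite /= !lmulE plh_mapP.
Qed.

Definition id_op_hom (A B : PL K) (f : mor (PL K) A B) :
    mor (OP K) (id_op A) (id_op B) :=
  OPHom (id_op_homP f).

Fact id_op_functor : is_functor id_op_hom.
Proof. by split=> *; apply: op_hom_eq. Qed.

Definition functorF : functor (PL K) (OP K) := Functor id_op_functor.

End FunctorF.

(* Main.v *)
(** An operator homomorphism [(phi, alpha)] out of [id_A] satisfies
    [T \o alpha = phi \o id_A], so [phi] is determined by [alpha]; conversely,
    each pre-Lie homomorphism [alpha : A -> (V, ._T)] extends to the operator
    homomorphism [(T \o alpha, alpha)].  Hence [(phi, alpha) |-> alpha] is the
    bijection of the adjunction, and its naturality is immediate. *)
Require Import Defs.
From mathcomp Require Import all_boot all_algebra.
Set Implicit Arguments.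
Unset Strict Implicit.
Unset Printing Implicit Defensive.
Import GRing.Theory.

Section Adjunction.
Variable K : fieldType.

(** Equivariance gives [alpha (rho (S x) y) = rho (phi (S x)) (alpha y)], and
    [phi \o S = T \o alpha] rewrites the acting element as [T (alpha x)]. *)
Lemma op_hom_pl_hom (S T : o_operator K)
    (phi : 'Hom(op_lie S, op_lie T)) (alpha : 'Hom(op_rep S, op_rep T)) :
  is_op_hom phi alpha ->
  @is_pl_hom K (induced_pre_lie S) (induced_pre_lie T) alpha.
Proof.
case=> _ alphaM eT x y; rewrite /= /op_mul alphaM.
by have /lfunP/(_ x) := eT; rewrite !lfunE /= => ->.
Qed.

Definition induced_hom (S T : OP K) (f : mor (OP K) S T) :
    mor (PL K) (induced_pre_lie S) (induced_pre_lie T) :=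
  @PLHom K (induced_pre_lie S) (induced_pre_lie T) (oph_rep f)
    (op_hom_pl_hom (oph_P f)).

Lemma induced_functor : is_functor induced_hom.
Proof. by split=> *; apply: pl_hom_eq. Qed.

Section Transpose.
Variables (A : pre_lie K) (T : o_operator K).

(** The product induced by [id_op A] is left multiplication in [A], so [op_hom_pl_hom] at [id_op A]
    transfers to [A]. *)
Lemma transposeP (f : op_hom (id_op A) T) :
  @is_pl_hom K A (induced_pre_lie T) (oph_rep f).
Proof.
move=> x y; have /= := op_hom_pl_hom (oph_P f) x y.
by rewrite /op_mul /= id_lfunE lmulE.
Qed.

Definition transpose (f : op_hom (id_op A) T) : pl_hom A (induced_pre_lie T) :=
  @PLHom K A (induced_pre_lie T) (oph_rep f) (transposeP f).

Lemma untransposeP (f : pl_hom A (induced_pre_lie T)) :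
  @is_op_hom K (id_op A) T (op_map T \o plh_map f)%VF (plh_map f).
Proof.
have fM (x y : A) :
    plh_map f (pl_mul x y) = op_mul (plh_map f x) (plh_map f y).
  exact: plh_mapP.
split; last by rewrite comp_lfun1r.
(* By [op_mapP], the bracket of [T (f x)] and [T (f y)] is [T] of the [op_mul] commutator of [f x]
   and [f y], which is [f] of the commutator in [A]. *)
- by move=> x y; rewrite /= !lfunE /= op_mapP /pl_br !linearB /= !fM.
- by move=> x v; rewrite /= lmulE fM lfunE.
Qed.

Definition untranspose (f : pl_hom A (induced_pre_lie T)) :
    op_hom (id_op A) T :=
  OPHom (untransposeP f).

Lemma transpose_bij : bijective transpose.
Proof.
exists untranspose => f; last exact: pl_hom_eq.
apply: op_hom_eq => //=.
by case: (oph_P f) => _ _ ->; rewrite comp_lfun1r.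
Qed.

End Transpose.
End Adjunction.

Theorem proposition4p20 (K : fieldType) :
  (forall (S T : o_operator K)
     (phi : 'Hom(op_lie S, op_lie T)) (alpha : 'Hom(op_rep S, op_rep T)),
     is_op_hom phi alpha ->
     @is_pl_hom K (induced_pre_lie S) (induced_pre_lie T) alpha) /\
  (exists homG : forall S T : OP K,
       mor (OP K) S T -> mor (PL K) (induced_pre_lie S) (induced_pre_lie T),
     (forall (S T : OP K) (f : mor (OP K) S T),
        plh_map (homG S T f) = oph_rep f) /\
     exists functG : is_functor homG,
       right_adjoint (Functor functG) (functorF K)).
Proof.
split; first exact: op_hom_pl_hom.
exists (@induced_hom K); split=> //; exists (@induced_functor K).
exists (@transpose K); split=> [A T | A A' T u f | A S T v f].
- exact: transpose_bij.
(* Both naturality squares hold by conversion on underlying maps, as composition in [OP] is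
   componentwise. *)
- exact: pl_hom_eq.
- exact: pl_hom_eq.
Qed.
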